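(* Let $H$ be a separable infinite-dimensional complex Hilbert space. The unitary operators on $H$ form a dense $G_\delta$ set in $(\mathcal{I},\mathrm{SOT})$ and in $(\mathcal{C},\mathrm{WOT})$. Moreover, the isometric operators form a dense $G_\delta$ set in $(\mathcal{C},\mathrm{WOT})$.
   Context: $\mathcal{C}$ and $\mathcal{I}$ denote the sets of contractions and of (linear, not necessarily surjective) isometries on $H$. WOT and SOT are the weak and strong operator topologies. *)

(* Defs.v *)
From HB Require Import structures.
From mathcomp Require Import all_boot all_order all_algebra sesquilinear.
From mathcomp Require Import all_classical all_reals all_analysis.
From mathcomp Require Import borel_hierarchy.

Set Implicit Arguments.
Unset Strict Implicit.
Unset Printing Implicit Defensive.

Import Order.TTheory GRing.Theory Num.Theory.
Import numFieldNormedType.Exports.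

Local Open Scope classical_set_scope.
Local Open Scope ring_scope.

Definition separable (T : topologicalType) : Prop :=
  exists2 D : set T, countable D & dense D.

Definition finite_dimensional (K : fieldType) (V : lmodType K) : Prop :=
  exists (n : nat) (e : 'I_n -> V),
    forall v : V, exists a : 'I_n -> K, v = \sum_(i < n) a i *: e i.

Record bounded_operator (C : numFieldType) (H : normedModType C) : Type :=
  BoundedOperator {
    operator_linear :> {linear H -> H};
    operator_continuous : continuous operator_linear }.

(* [initial_topology] needs a [choiceType] *)
HB.instance Definition _ (C : numFieldType) (H : normedModType C) :=
  gen_eqMixin (bounded_operator H).
HB.instance Definition _ (C : numFieldType) (H : normedModType C) :=
  gen_choiceMixin (bounded_operator H).

Section operators.
Context (C : numClosedFieldType) (H : normedModType C).
Context (dot : {dot H for Num.conj}).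

(* the coarsest topology making every T |-> T x continuous *)
Definition SOT : topologicalType :=
  initial_topology
    (fun T : bounded_operator H => (fun x => T x) : {ptws H -> H}).

(* the coarsest topology making every T |-> <T x, y> continuous *)
Definition WOT : topologicalType :=
  initial_topology
    (fun T : bounded_operator H =>
       (fun xy => dot (T xy.1) xy.2) : {ptws H * H -> C}).

Definition contractions : set (bounded_operator H) :=
  [set T | forall x, `|T x| <= `|x|].

Definition isometries : set (bounded_operator H) :=
  [set T | forall x, `|T x| = `|x|].

Definition is_adjoint (T S : bounded_operator H) : Prop :=
  forall x y, dot (T x) y = dot x (S y).

Definition unitaries : set (bounded_operator H) :=
  [set T | exists S : bounded_operator H,
     [/\ is_adjoint T S, cancel T S & cancel S T]].

End operators.

Arguments SOT {C} H.
Arguments contractions {C} H.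
Arguments isometries {C} H.

(* [set_type A] carries the relative topology; with the library's [subspace A]
   the points outside [A] would be isolated, and lie in the closure of no subset of [A]. *)
Definition dense_Gdelta_in (T : topologicalType) (A B : set T) : Prop :=
  let B' : set (set_type A) := [set x | B (set_val x)] in
  [/\ B `<=` A, dense B' & Gdelta B'].

(* Main.v *)
(* Both density statements come from exact agreement on finite sets. If the
   vectors x_1, .., x_n and z_1, .., z_n have the same Gram matrix, a product of
   n complex Householder maps is a unitary sending each x_i to z_i. For an
   isometry T take z_i = T x_i. For a contraction T and test vectors y_j take
   z_i = T x_i + w_i, where the w_i are orthogonal to all T x_k and y_j and have
   Gram matrix <x_i, x_k> - <T x_i, T x_k>; this matrix is positive semidefinite,
   and the w_i exist by Cholesky factorization because H is infinite-dimensional.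
   For the G_delta statements, let D be a countable dense set. A contraction T is
   isometric iff for all v, d in D with d <> 0 some y in the unit ball satisfies
   |<T v, y>| > |v| - |d|, and an isometric T is onto iff likewise some x in the
   unit ball satisfies |<T x, v>| > |v| - |d|. Each of these conditions is open
   for both topologies. *)

From HB Require Import structures.
Require Import Defs.
From mathcomp Require Import all_boot all_order all_algebra sesquilinear.
From mathcomp Require Import all_classical all_reals all_analysis.
From mathcomp Require Import complex.
From mathcomp Require Import borel_hierarchy ring.

Import Order.TTheory GRing.Theory Num.Theory.
Import numFieldNormedType.Exports.

Local Open Scope classical_set_scope.
Local Open Scope ring_scope.
Local Open Scope complex_scope.

(** * Positive semidefinite Hermitian forms *)

Definition psd_form {C : numClosedFieldType} {V : lmodType C}
    (q : V -> V -> C) : Prop :=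
  [/\ forall y, scalar (q^~ y), forall x y, q x y = (q y x)^*%R
    & forall x, 0 <= q x x].

Section psd_forms.
Context {C : numClosedFieldType} {V : lmodType C} {q : V -> V -> C}.
Hypothesis psd_q : psd_form q.

Lemma psd_linearPl a x y z : q (a *: x + y) z = a * q x z + q y z.
Proof. by have [lq _ _] := psd_q; rewrite lq. Qed.

Lemma psd_conj x y : q x y = (q y x)^*%R.
Proof. by have [_ hq _] := psd_q. Qed.

Lemma psd_linearPr a x y z : q z (a *: x + y) = a^*%R * q z x + q z y.
Proof. by rewrite psd_conj psd_linearPl rmorphD rmorphM /= -!psd_conj. Qed.

Lemma psd_ge0 x : 0 <= q x x.
Proof. by have [_ _ pq] := psd_q. Qed.

Lemma psd_degenerate x y : q y y = 0 -> q x y = 0.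
Proof.
move=> qy0; apply/eqP/negP => /negP qxy0.
have n0 : `|q x y| ^+ 2 != 0 by rewrite expf_neq0 // normr_eq0.
(* This [s] gives [q] the value [- (q x x + 2)], which is negative, at x - s q(x, y) y. *)
pose s := (q x x + 1) / `|q x y| ^+ 2.
have sC : s^*%R = s.
  by apply/conj_Creal/ger0_real; rewrite divr_ge0 ?exprn_ge0 ?addr_ge0 ?psd_ge0.
have := psd_ge0 (- (s * q x y) *: y + x).
rewrite psd_linearPl !psd_linearPr qy0 mulr0 add0r (psd_conj y x).
rewrite rmorphN rmorphM /= sC.
have -> : - (s * q x y) * (q x y)^*%R + (- (s * (q x y)^*%R) * q x y + q x x) =
          - (q x x + 2).
  have -> : q x x + 2 = (s * `|q x y| ^+ 2) *+ 2 - q x x.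
    by rewrite /s divfK //; ring.
  by rewrite normCK; ring.
by rewrite oppr_ge0 lt_geF // ltr_wpDl ?psd_ge0 // ltr0n.
Qed.

(** The vector on the left is x minus its [q]-projection onto y. Its nonnegative value yields both
    the Cauchy-Schwarz inequality and the positivity of Schur complements. *)
Lemma psd_residual x y : q y y != 0 ->
  q (- (q x y / q y y) *: y + x) (- (q x y / q y y) *: y + x) =
  q x x - `|q x y| ^+ 2 / q y y.
Proof.
move=> qy0; have qyC : (q y y)^*%R = q y y by rewrite -psd_conj.
rewrite psd_linearPl !psd_linearPr (psd_conj y x) normCK.
rewrite rmorphN rmorphM /= fmorphV /= qyC.
by field.
Qed.

Lemma psd_cauchy_schwarz x y : `|q x y| ^+ 2 <= q x x * q y y.
Proof.
have [qy0|qy0] := eqVneq (q y y) 0.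
  by rewrite (psd_degenerate x _ qy0) qy0 normr0 expr0n mulr0.
have := psd_ge0 (- (q x y / q y y) *: y + x).
by rewrite psd_residual // subr_ge0 ler_pdivrMr // lt0r qy0 psd_ge0.
Qed.

End psd_forms.

(* The Schur complement step of the Cholesky factorization. *)
Lemma psd_schur (C : numClosedFieldType) (V : lmodType C) (q : V -> V -> C) z :
  psd_form q ->
  psd_form (fun x y => q x y - q x z * q z y / q z z).
Proof.
move=> qP; split.
- move=> y a u v /=.
  by rewrite !(psd_linearPl qP) /GRing.scale /=; ring.
- move=> x y; rewrite rmorphB !rmorphM /= fmorphV /= -!(psd_conj qP).
  by rewrite mulrC [q x z * _]mulrC mulrC.
(* If [q z z] is 0, so is its inverse, and the correction term disappears. *)
- move=> x /=; have [z0|z0] := eqVneq (q z z) 0.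
    by rewrite z0 invr0 mulr0 subr0 (psd_ge0 qP).
  rewrite (psd_conj qP z x) -normCK -(psd_residual qP) //.
  exact: psd_ge0.
Qed.

(** * Inner product, isometries and unitaries *)

Section pre_hilbert.
Context {C : numClosedFieldType} {H : normedModType C}.
Context {dot : {dot H for Num.conj}}.
Hypothesis norm_dot : forall x : H, `|x| = sqrtC (dot x x).

Lemma dot_psd : psd_form dot.
Proof.
split=> [y a u v|x y|x]; first exact: linearPl.
- by rewrite hermC /= expr0 mul1r.
- exact: dnorm_ge0.
Qed.

Lemma dotC x y : dot x y = (dot y x)^*%R.
Proof. exact: (psd_conj dot_psd). Qed.

Lemma dotZl a x y : dot (a *: x) y = a * dot x y.
Proof. exact: linearZl_LR. Qed.

Lemma dotZr a x y : dot x (a *: y) = a^*%R * dot x y.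
Proof. exact: linearZr_LR. Qed.

Lemma dot_norm x : dot x x = `|x| ^+ 2.
Proof. by rewrite norm_dot sqrtCK. Qed.

Lemma cauchy_schwarz x y : `|dot x y| <= `|x| * `|y|.
Proof.
rewrite -(@ler_pXn2r _ 2) ?nnegrE ?mulr_ge0 // exprMn -!dot_norm.
exact: (psd_cauchy_schwarz dot_psd).
Qed.

Section linear_maps.
Context {T : {linear H -> H}}.

Lemma contraction_defect_psd : (forall x, `|T x| <= `|x|) ->
  psd_form (fun x y => dot x y - dot (T x) (T y)).
Proof.
move=> Tle; split=> [y a u v|x y|x].
- by rewrite linearP !(psd_linearPl dot_psd) /GRing.scale /=; ring.
- by rewrite rmorphB /= -!dotC.
- by rewrite subr_ge0 !dot_norm ler_pXn2r ?nnegrE.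
Qed.

(** The defect form <x, y> - <T x, T y> is positive semidefinite and vanishes on the diagonal, hence
    everywhere by Cauchy-Schwarz degeneracy; this stands in for polarization. *)
Lemma isometry_dot : (forall x, `|T x| = `|x|) ->
  forall x y, dot (T x) (T y) = dot x y.
Proof.
move=> Tiso x y; apply/esym/eqP; rewrite -subr_eq0; apply/eqP.
have Tle z : `|T z| <= `|z| by rewrite Tiso.
apply: (psd_degenerate (contraction_defect_psd Tle)).
by rewrite !dot_norm Tiso subrr.
Qed.

End linear_maps.

Lemma isometric_operator (f : H -> H) : linear f -> (forall x, `|f x| = `|x|) ->
  exists T : bounded_operator H, T =1 f.
Proof.
move=> lf isof.
pose F : {linear H -> H} := HB.pack f (GRing.isLinear.Build C H H _ f lf).
suff cF : continuous F by exists (BoundedOperator cF).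
move=> x; apply/cvgrPdist_lt => e e0.
apply/nbhs_ballP; exists e => // y.
rewrite -ball_normE /= => xye; change (`|F x - F y| < e).
by rewrite -linearB /= isof.
Qed.

Lemma isometry_inj (f : H -> H) : linear f -> (forall x, `|f x| = `|x|) ->
  injective f.
Proof.
move=> lf isof; have [T Tf] := isometric_operator f lf isof.
move=> x y; rewrite -!Tf => Txy; apply/eqP.
by rewrite -subr_eq0 -normr_eq0 -isof -Tf linearB Txy subrr normr0.
Qed.

(** The inverse g is again linear and isometric, and it is the adjoint because <f x, y> = <f x, f (g
    y)> = <x, g y>. *)
Lemma unitary_of_surjective_isometry (f : H -> H) :
  linear f -> (forall x, `|f x| = `|x|) -> (forall y, exists x, f x = y) ->
  exists2 U, unitaries dot U & U =1 f.
Proof.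
move=> lf isof /choice[g fgK].
have finj := isometry_inj f lf isof.
have gfK : cancel f g by move=> x; apply: finj; rewrite fgK.
have lg : linear g by move=> a x y; apply: finj; rewrite lf !fgK.
have isog x : `|g x| = `|x| by rewrite -isof fgK.
have [U Uf] := isometric_operator f lf isof.
have [S Sg] := isometric_operator g lg isog.
exists U => //; exists S; split=> [x y|x|x]; rewrite ?Uf ?Sg //.
have isoU z : `|U z| = `|z| by rewrite Uf.
by rewrite -{1}[y]fgK -Uf -[f (g y)]Uf isometry_dot.
Qed.

Lemma unitary_isometry : unitaries dot `<=` isometries H.
Proof.
move=> U [S [US UK _]] x.
by rewrite norm_dot US UK -norm_dot.
Qed.

Lemma surjective_isometry_unitary (T : bounded_operator H) :
  isometries H T -> (forall y, exists x, T x = y) -> unitaries dot T.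
Proof.
move=> isoT surT.
have [|U [S [US UK SK]] UT] := unitary_of_surjective_isometry T _ isoT surT.
  exact: linearP.
exists S; split=> [x y|x|x]; first by rewrite -UT US.
- by rewrite -UT UK.
- by rewrite -UT SK.
Qed.

(** * Householder maps and unitary extension *)

(* The complex Householder map x - (<x, v> / <a, v>) v, where v = a - b; since
   |a| = |b|, Re <a, v> = |v|^2 / 2, which makes it unitary. *)
Lemma householder (a b : H) : `|a| = `|b| ->
  exists r : H -> H, [/\ linear r, forall x, `|r x| = `|x|,
    forall y, exists x, r x = y, r a = b &
    forall x, dot x a = dot x b -> r x = x].
Proof.
move=> nab; have [<-|ab] := eqVneq a b.
  by exists id; split=> // y; exists y.
pose v := a - b; pose d := dot a v.
have vv : dot v v = d + d^*%R.
  rewrite /d /v dnormB linearBr /= rmorphB /= (dot_norm b) -nab -dot_norm.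
  by rewrite -(dotC a a); ring.
have d0 : d != 0.
  apply: contra_neq ab => d0; apply/eqP.
  by rewrite -subr_eq0 -(dnorm_eq0 dot) -/v vv d0 rmorph0 addr0.
have dC0 : d^*%R != 0 by rewrite conjC_eq0.
exists (fun x => x - (dot x v / d) *: v); split.
- move=> k x y; rewrite (psd_linearPl dot_psd) mulrDl scalerDl -mulrA -scalerA.
  by rewrite opprD addrACA -scalerBr.
- move=> x; apply/eqP; rewrite -(@eqrXn2 _ 2) // -!dot_norm dnormB.
  rewrite dotZl !dotZr vv !rmorphM /= !fmorphV /=.
  apply/eqP; move: (dot x v) => w; rewrite !conjCK.
  by field; rewrite d0 dC0.
(* The preimage comes from the adjoint map, in which [d] is replaced by its conjugate. *)
- move=> y; exists (y - (dot y v / d^*%R) *: v).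
  rewrite linearBl /= dotZl vv -addrA -opprD -scalerDl.
  have -> : dot y v / d^*%R + (dot y v - dot y v / d^*%R * (d + d^*%R)) / d = 0.
    by field; rewrite d0 dC0.
  by rewrite scale0r subr0.
- by rewrite -/d divff // scale1r /v opprB addrC subrK.
- by move=> x xab; rewrite /v linearBr /= xab subrr mul0r scale0r subr0.
Qed.

(** Induction on the list: if U agrees with z on [xs], compose it with the Householder map taking U
    x0 to z x0. That map fixes each z x with x in [xs], since <z x, U x0> = <U x, U x0> = <x, x0> =
    <z x, z x0>. *)
Lemma unitary_extension (xs : seq H) (z : H -> H) :
  {in xs &, forall x y, dot (z x) (z y) = dot x y} ->
  exists2 U, unitaries dot U & {in xs, U =1 z}.
Proof.
elim: xs => [_|x0 xs IH zP].
  have [//|//|y|U UU _] := unitary_of_surjective_isometry id; first by exists y.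
  by exists U.
have [x y xxs yxs|U UU Uz] := IH.
  by apply: zP; rewrite inE ?xxs ?yxs orbT.
have isoU := unitary_isometry U UU.
have [|r [lr isor surr r0 rfix]] := householder (U x0) (z x0).
  by rewrite isoU !norm_dot zP // inE eqxx.
have [k x y|x|y|V VV Vr] := unitary_of_surjective_isometry (r \o U).
- by rewrite /= linearP lr.
- by rewrite /= isor isoU.
- have [y' <-] := surr y; have [S [_ _ SK]] := UU.
  by exists (S y'); rewrite /= SK.
exists V => // x; rewrite Vr /= inE => /orP[/eqP ->//|xxs].
rewrite rfix; first exact: Uz.
by rewrite (isometry_dot isoU) Uz // zP // inE ?eqxx // xxs orbT.
Qed.

(** * Orthogonal vectors and prescribed Gram matrices *)

Lemma finite_span_residual (L : seq H) : exists n (e : 'I_n -> H),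
  forall v, exists a : 'I_n -> C,
    {in L, forall l, dot (v - \sum_(i < n) a i *: e i) l = 0}.
Proof.
elim: L => [|l L [n [e eP]]]; first by exists 0, (fun=> 0) => v; exists (fun=> 0).
(* Either some u orthogonal to [L] pairs nontrivially with l, and adding u to the family corrects
   the pairing with l; or orthogonality to [L] already forces orthogonality to l. *)
have [[u uL ul]|uN] :=
    pselect (exists2 u, {in L, forall l', dot u l' = 0} & dot u l != 0).
  exists n.+1, (fun i => if unlift ord0 i is Some j then e j else u) => v.
  have [a aP] := eP v; set w := v - _ in aP.
  exists (fun i => if unlift ord0 i is Some j then a j else dot w l / dot u l).
  rewrite big_ord_recl unlift_none.
  under eq_bigr do rewrite liftK.
  move=> l'; rewrite opprD addrCA -/w addrC.
  rewrite linearBl /= dotZl inE => /orP[/eqP ->|l'L].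
    by rewrite divfK // subrr.
  by rewrite aP // (uL l') // mulr0 subrr.
exists n, e => v; have [a aP] := eP v; exists a => l'.
rewrite inE => /orP[/eqP ->|]; last exact: aP.
by apply/eqP/negP => /negP wl; apply: uN; eexists; [exact: aP|].
Qed.

(** If only 0 were orthogonal to [L], all residuals of [finite_span_residual] would vanish and its
    finite family would span the space. *)
Lemma orthogonal_unit_vector (L : seq H) : ~ finite_dimensional H ->
  exists2 u : H, `|u| = 1 & {in L, forall l, dot u l = 0}.
Proof.
move=> infH; have [n [e eP]] := finite_span_residual L.
have [[u u0 uL]|uN] :=
    pselect (exists2 u, u != 0 & {in L, forall l, dot u l = 0}).
  exists (`|u|^-1 *: u) => [|l lL]; last by rewrite dotZl uL // mulr0.
  by rewrite normrZ normfV normr_id mulVf // normr_eq0.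
exfalso; apply: infH; exists n, e => v; have [a aP] := eP v; exists a.
apply/eqP; rewrite -subr_eq0; apply/negP => /negP w0.
by apply: uN; eexists; [exact: w0|exact: aP].
Qed.

(** Cholesky induction: realize the Schur complement at x0 by vectors orthogonal to a fresh unit
    vector f and to [L], then restore the rank-one term q(x, x0) q(x0, y) / q(x0, x0) along f. *)
Lemma gram_realization (q : H -> H -> C) (xs L : seq H) :
  ~ finite_dimensional H -> psd_form q ->
  exists w : H -> H, {in xs &, forall x y, dot (w x) (w y) = q x y} /\
    {in xs & L, forall x l, dot (w x) l = 0}.
Proof.
move=> infH; elim: xs q L => [|x0 xs IH] q L qP; first by exists id.
have [f f1 fL] := orthogonal_unit_vector L infH.
have [w [wq wL]] := IH _ (f :: L) (psd_schur C H q x0 qP).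
(* The induction hypothesis says nothing about [w x0] when x0 is not in [xs]. The value 0 is right
   there because the row and column of x0 in the Schur complement vanish. *)
pose wt x := if x \in xs then w x else 0.
pose c x := q x x0 / sqrtC (q x0 x0).
have wt_in x : x \in xs -> wt x = w x by rewrite /wt => ->.
have wtL x l : l \in f :: L -> dot (wt x) l = 0.
  by rewrite /wt; case: ifP => [xxs lL|_ _]; rewrite ?wL ?linear0l.
have wtf x : dot (wt x) f = 0 by rewrite wtL // inE eqxx.
have schur0 x : q x x0 - q x x0 * q x0 x0 / q x0 x0 = 0.
  have [q0|q0] := eqVneq (q x0 x0) 0; last by rewrite mulfK // subrr.
  by rewrite q0 mulr0 mul0r subr0 (psd_degenerate qP).
have wtq : {in x0 :: xs &, forall x y,
    dot (wt x) (wt y) = q x y - q x x0 * q x0 y / q x0 x0}.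
  have wt_head x y : x = x0 -> x \notin xs ->
      dot (wt x) (wt y) = q x y - q x x0 * q x0 y / q x0 x0.
    move=> -> x0N; rewrite {1}/wt (negPf x0N) linear0l.
    have /(congr1 Num.conj) := schur0 y.
    rewrite rmorph0 rmorphB !rmorphM /= fmorphV /= -!(psd_conj qP) => <-.
    by rewrite [q x0 y * _]mulrC.
  move=> x y; rewrite 2!inE => xP yP.
  case xxs: (x \in xs); last first.
    by apply: wt_head; rewrite ?xxs //; move: xP; rewrite xxs orbF => /eqP.
  case yxs: (y \in xs); first by rewrite !wt_in // wq.
  rewrite dotC wt_head ?yxs //; last by move: yP; rewrite yxs orbF => /eqP.
  rewrite rmorphB !rmorphM /= fmorphV /= -!(psd_conj qP).
  by rewrite [q x0 y * _]mulrC.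
exists (fun x => wt x + c x *: f); split=> [x y xP yP|x l xP lL]; last first.
  by rewrite linearDl /= dotZl fL // wtL ?inE ?lL ?orbT // mulr0 addr0.
rewrite linearDl !linearDr /= !dotZl !dotZr dot_norm f1 (dotC f) !wtf.
rewrite rmorph0 !mulr0 add0r addr0 wtq // expr1n mulr1.
have sC : (sqrtC (q x0 x0))^*%R = sqrtC (q x0 x0).
  by apply/conj_Creal/ger0_real; rewrite sqrtC_ge0 (psd_ge0 qP).
rewrite /c rmorphM /= fmorphV /= sC -(psd_conj qP) mulrACA -invfM -expr2 sqrtCK.
by rewrite subrK.
Qed.

(** * Countable criteria for isometry and dense range *)

Lemma norming_vector (v : H) : exists2 y : H, `|y| <= 1 & dot v y = `|v|.
Proof.
have [->|v0] := eqVneq v 0.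
  by exists 0; rewrite ?normr0 // linear0l.
have nv0 : `|v| != 0 by rewrite normr_eq0.
exists (`|v|^-1 *: v); first by rewrite normrZ normfV normr_id mulVf.
rewrite dotZr dot_norm conj_Creal ?ger0_real ?invr_ge0 //.
by rewrite expr2 mulKf.
Qed.

Lemma dot_continuous_left (y : H) : continuous (fun x => dot x y).
Proof.
move=> x; apply/cvgrPdist_lt => e e0.
have y0 : 0 < `|y| + 1 by rewrite ltr_wpDl.
apply/nbhs_ballP; exists (e / (`|y| + 1)) => [|z]; first exact: divr_gt0.
rewrite -ball_normE /= -linearBl /= ltr_pdivlMr //; apply: le_lt_trans.
by apply: le_trans (cauchy_schwarz _ _) _; rewrite ler_wpM2l // lerDl.
Qed.

Section sequential_criteria.
Context {d : nat -> H}.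
Hypothesis d_dense : forall x e, 0 < e -> exists k, `|x - d k| < e.

(* The slacks |d j|, for d j <> 0, are countably many and arbitrarily small. *)
Definition norming (v : H) (j : nat) (P : H -> C) : Prop :=
  d j = 0 \/ exists2 y, `|y| <= 1 & `|v| - `|d j| < `|P y|.

Lemma norming_exact v j P y : `|y| <= 1 -> `|P y| = `|v| -> norming v j P.
Proof.
move=> y1 Py; have [|dj0] := eqVneq (d j) 0; [by left|right].
by exists y => //; rewrite Py gtrBl normr_gt0.
Qed.

Lemma norming_approx (u : H) v P e : u != 0 -> 0 < e ->
  (forall j, norming v j P) -> exists2 y, `|y| <= 1 & `|v| - e < `|P y|.
Proof.
move=> u0 e0 vP; have nu0 : 0 < `|u| by rewrite normr_gt0.
have e2 : 0 < e / 2 by rewrite divr_gt0.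
(* Since |x| = e/2, a point [d j] within less than e/2 of x is nonzero and has norm at most e: an
   admissible slack. *)
pose x := (e / 2 / `|u|) *: u.
have nx : `|x| = e / 2.
  by rewrite normrZ ger0_norm ?divr_ge0 ?(ltW e0) // divfK // gt_eqF.
have [j xj] := d_dense x _ e2.
case: (vP j) => [dj0|[y y1 yP]].
  by move: xj; rewrite dj0 subr0 nx ltxx.
exists y => //; apply: le_lt_trans yP; rewrite lerD2l lerN2.
have -> : d j = x - (x - d j) by rewrite opprB addrC subrK.
by rewrite (le_trans (ler_normB _ _)) // nx [leRHS]splitr lerD2l ltW.
Qed.

Lemma isometry_criterion (u : H) (T : bounded_operator H) : u != 0 ->
  contractions H T ->
  isometries H T <-> forall k j, norming (d k) j (dot (T (d k))).
Proof.
move=> u0 cT; split=> [isoT k j|TP x].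
  have [y y1 Ty] := norming_vector (T (d k)).
  by apply: (norming_exact _ _ _ _ y1); rewrite Ty normr_id isoT.
apply/eqP; rewrite eq_le cT /=; apply/ler_addgt0Pr => e e0.
(* The three errors are |x| against |d k|, |d k| against |T (d k)| by the norming condition, and |T
   (d k)| against |T x| by contractivity. *)
have e3 : 0 < e / 3 by rewrite divr_gt0.
have [k xk] := d_dense x _ e3.
have [y y1 yP] := norming_approx _ _ _ _ u0 e3 (TP k).
have Tdk : `|dot (T (d k)) y| <= `|T (d k)|.
  by apply: le_trans (cauchy_schwarz _ _) _; rewrite ler_piMr.
have Tk : `|T (d k)| <= `|T x| + e / 3.
  have -> : T (d k) = T x - T (x - d k) by rewrite linearB opprB addrC subrK.
  rewrite (le_trans (ler_normB _ _)) // lerD2l (le_trans (cT _)) // ltW //.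
have xd : `|x| <= `|d k| + e / 3.
  have -> : x = d k + (x - d k) by rewrite addrC subrK.
  rewrite (le_trans (ler_normD _ _)) // lerD2l ltW //.
have dk : `|d k| <= `|T x| + e / 3 + e / 3.
  by rewrite -lerBlDr (le_trans (ltW yP)) // (le_trans Tdk).
have -> : `|T x| + e = `|T x| + e / 3 + e / 3 + e / 3 by field.
by rewrite (le_trans xd) // lerD2r.
Qed.

Lemma dense_range_of_norming (u : H) (T : bounded_operator H) : u != 0 ->
  isometries H T -> (forall k j, norming (d k) j (fun x => dot (T x) (d k))) ->
  forall y e, 0 < e -> exists z, `|y - T z| < e.
Proof.
move=> u0 isoT TP y e e0.
have e2 : 0 < e / 2 by rewrite divr_gt0.
have [k yk] := d_dense y _ e2.
(* [m] bounds |d k| + |a| for the pairing [a] below; the summand 1 keeps it positive when [d k] is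
   0. *)
pose m := 2 * `|d k| + 1; have m0 : 0 < m by rewrite ltr_wpDl ?mulr_ge0.
have ee0 : 0 < (e / 2) ^+ 2 / m by rewrite divr_gt0 ?exprn_gt0.
have [x x1 xP] := norming_approx _ _ _ _ u0 ee0 (TP k).
set a := dot (T x) (d k) in xP.
have ad : `|a| <= `|d k|.
  by apply: le_trans (cauchy_schwarz _ _) _; rewrite isoT ler_piMl.
(* The conjugate of [a] is <d k, T x>, the coefficient for projecting [d k] onto T x. As |T x| = |x|
   <= 1, the squared distance from [d k] is at most |d k|^2 - |a|^2 = (|d k| - |a|)(|d k| + |a|). *)
exists (a^*%R *: x).
have -> : y - T (a^*%R *: x) = (y - d k) + (d k - T (a^*%R *: x)).
  by rewrite addrA subrK.
apply: le_lt_trans (ler_normD _ _) _; rewrite [e]splitr ltrD //.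
rewrite -(@ltr_pXn2r _ 2) ?nnegrE ?(ltW e2) // -dot_norm linearZ /= dnormB.
rewrite dnormZ !dot_norm isoT dotZr conjCK norm_conjC.
have -> : dot (d k) (T x) = a^*%R by rewrite dotC.
have aa : `|a| ^+ 2 * `|x| ^+ 2 <= `|a| ^+ 2.
  by rewrite ler_piMr ?exprn_ge0 // expr_le1.
rewrite rmorphM /= conjCK [a^*%R * a]mulrC -normCK.
apply: le_lt_trans (_ : (`|d k| - `|a|) * m < _); last first.
  by rewrite -ltr_pdivlMr // ltrBlDl -ltrBlDr.
apply: le_trans (_ : (`|d k| - `|a|) * (`|d k| + `|a|) <= _).
  rewrite -subr_sqr opprD addrA -subr_ge0.
  have -> : `|d k| ^+ 2 - `|a| ^+ 2 -
     (`|d k| ^+ 2 + `|a| ^+ 2 * `|x| ^+ 2 - `|a| ^+ 2 - `|a| ^+ 2) =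
     `|a| ^+ 2 - `|a| ^+ 2 * `|x| ^+ 2 by ring.
  by rewrite subr_ge0.
rewrite ler_wpM2l ?subr_ge0 // /m mulr2n mulrDl mul1r -addrA lerD2l.
by rewrite (le_trans ad) // lerDl.
Qed.

End sequential_criteria.

Lemma unitary_norming (d : nat -> H) (T : bounded_operator H) :
  unitaries dot T -> forall k j, norming (d := d) (d k) j (fun x => dot (T x) (d k)).
Proof.
move=> UT k j; have isoT := unitary_isometry T UT.
have [S [_ _ SK]] := UT.
have [y y1 dy] := norming_vector (d k).
apply: (norming_exact _ _ _ (S y)); first by rewrite -isoT SK.
by rewrite SK dotC dy norm_conjC normr_id.
Qed.

(** The threshold |d k| - |d j| does not depend on t, so each y gives an open condition, and the
    existential over y is a union. *)
Lemma open_norming (X : topologicalType) (g : X -> H -> C) (d : nat -> H) k j :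
  (forall y, continuous (g^~ y)) -> open [set t | norming (d := d) (d k) j (g t)].
Proof.
move=> cg; have [dj0|dj0] := eqVneq (d j) 0.
  rewrite (_ : [set t | _] = setT); first exact: openT.
  by apply/seteqP; split=> // t _; left.
have -> : [set t | norming (d := d) (d k) j (g t)] =
    \bigcup_(y in [set y | `|y| <= 1])
      [set t | `|d k| - `|d j| < `|g t y|].
  apply/seteqP; split=> t.
    by case=> [dj|[y y1 yP]]; [rewrite dj eqxx in dj0|exists y].
  by case=> y y1 yP; right; exists y.
apply: bigcup_open => y _; rewrite openE => t tP.
exact: (cvgr_norm_gt _ (cg y t) _ tP).
Qed.

End pre_hilbert.

(** * Completeness, separability and topological tools *)

Lemma isometry_surjective (C : numClosedFieldType) (H : completeNormedModType C)
    (T : bounded_operator H) : isometries H T ->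
  (forall y e, 0 < e -> exists z, `|y - T z| < e) -> forall y, exists x, T x = y.
Proof.
move=> isoT Tdense y.
(* [F] is generated by the preimages under T of balls around y. It is Cauchy because T preserves
   distances, and T maps its limit to y. *)
pose F : set_system H :=
  [set A | exists2 e, 0 < e & forall z, `|y - T z| < e -> A z].
have FF : ProperFilter F.
  split=> [[e e0 eF]|]; first by have [z zP] := Tdense y e e0; apply: (eF z).
  split=> [|A B [e e0 eA] [r r0 rB]|A B AB [e e0 eA]].
  - by exists 1.
  - have [er|/ltW re] := real_leP (gtr0_real e0) (gtr0_real r0).
      by exists e => // z ze; split; [exact: eA|exact: rB (lt_le_trans ze er)].
    by exists r => // z zr; split; [exact: eA (lt_le_trans zr re)|exact: rB].
  - by exists e => // z /eA /AB.
have cF : cauchy F.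
  apply: cauchy_exP => e e0; have e2 : 0 < e / 2 by rewrite divr_gt0.
  have [z zy] := Tdense y _ e2.
  exists z, (e / 2) => // x xy; rewrite -ball_normE /= -isoT linearB /=.
  have -> : T z - T x = (y - T x) - (y - T z).
    by rewrite opprB [RHS]addrC addrA subrK.
  by rewrite (le_lt_trans (ler_normB _ _)) // [e]splitr ltrD.
have /cvg_ex[x Fx] : cvg F by exact: cauchy_cvg.
exists x; have TFx : T z @[z --> F] --> T x.
  by apply: (cvg_trans (cvg_app T Fx)); exact: operator_continuous.
have TFy : T z @[z --> F] --> y by apply/cvgrPdist_lt => e e0; exists e.
exact: (norm_cvg_unique TFx TFy).
Qed.

Lemma separable_sequence (K : numFieldType) (V : normedModType K) :
  separable V -> exists d : nat -> V, forall x e, 0 < e -> exists k, `|x - d k| < e.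
Proof.
move=> [D cD dD].
have near_D x e : 0 < e -> exists2 v, D v & `|x - v| < e.
  move=> e0; have [||v [vx Dv]] := dD (ball x e).
  - by exists x; exact: ballxx.
  - exact: ball_open.
  - by exists v => //; move: vx; rewrite -ball_normE.
have [D0|[f]] := pfcard_geP cD.
  by have [v] := near_D 0 1 ltr01; rewrite D0.
exists f => x e e0; have [v Dv vx] := near_D x e e0; have [k _ kv] := 'surj_f Dv.
by exists k; rewrite kv.
Qed.

Lemma Gdelta_forall2 (X : topologicalType) (O : nat -> nat -> set X) :
  (forall k j, open (O k j)) -> Gdelta [set t | forall k j, O k j t].
Proof.
move=> oO.
(* Indices coding no pair contribute the whole space. *)
exists (fun i => if unpickle i is Some (k, j) then O k j else setT) => [i|].
  by case: unpickle => [[k j]|]; [exact: oO|exact: openT].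
apply/seteqP; split=> t tP => [i _|k j]; first by case: unpickle => [[k j]|//].
by have := tP (pickle (k, j)) I; rewrite pickleK.
Qed.

(* The filter of sets containing all functions that agree with [phi T] on some
   finite list converges pointwise to [phi T]. *)
Lemma dense_of_finite_agreement (S : choiceType) (I : topologicalType)
    (V : uniformType) (phi : S -> I -> V) (A B : set S) : B `<=` A ->
  (forall T (s : seq I), A T -> exists2 U, B U & {in s, phi U =1 phi T}) ->
  dense ([set x | B (set_val x)] :
    set (set_type (A : set (initial_topology (phi : S -> {ptws I -> V}))))).
Proof.
move=> BA agree O [x Ox] [_ [W oW <-] WO].
pose F : set_system {ptws I -> V} :=
  [set Q | exists s : seq I, forall g, {in s, g =1 phi (set_val x)} -> Q g].
have FF : Filter F.
  split=> [|P Q [s sP] [r rQ]|P Q PQ [s sP]].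
  - by exists [::].
  - exists (s ++ r) => g gP; split; [apply: sP|apply: rQ] => i iP;
      by apply: gP; rewrite mem_cat iP ?orbT.
  - by exists s => g /sP/PQ.
have Fx : {ptws, F --> phi (set_val x)}.
  apply/pointwise_cvgP => i Q Qi; exists [:: i] => g gi.
  by rewrite /= gi ?inE //; exact: nbhs_singleton.
have [s sW] : F W.
  by apply: Fx; apply: open_nbhs_nbhs; split=> //; move: Ox; rewrite -WO.
have Ax : A (set_val x) by apply: set_mem; exact: (valP x).
have [U BU Us] := agree _ s Ax.
exists (exist _ U (mem_set (BA _ BU))); split=> //.
by rewrite -WO; apply: sW.
Qed.

(** * Continuity of matrix coefficients and density of the unitaries *)

Section operator_topologies.
Context {C : numClosedFieldType} {H : normedModType C}.
Context {dot : {dot H for Num.conj}}.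
Hypothesis norm_dot : forall x : H, `|x| = sqrtC (dot x x).

Lemma SOT_continuous_dot (A : set (SOT H)) x y :
  continuous (fun t : set_type A => dot ((set_val t : bounded_operator H) x) y).
Proof.
have c1 : continuous (fun t : set_type A => set_val t : SOT H).
  exact: initial_continuous.
have c2 : continuous (fun T : SOT H =>
    ((fun x => (T : bounded_operator H) x) : {ptws H -> H})).
  exact: initial_continuous.
have c3 : continuous (fun f : {ptws H -> H} => f x) by exact: proj_continuous.
move=> t; have c4 := dot_continuous_left norm_dot y.
exact: (continuous_comp (continuous_comp (continuous_comp (c1 t) (c2 _)) (c3 _))
  (c4 _)).
Qed.

Lemma WOT_continuous_dot (A : set (WOT dot)) x y :
  continuous (fun t : set_type A => dot ((set_val t : bounded_operator H) x) y).
Proof.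
have c1 : continuous (fun t : set_type A => set_val t : WOT dot).
  exact: initial_continuous.
have c2 : continuous (fun T : WOT dot =>
    ((fun xy => dot ((T : bounded_operator H) xy.1) xy.2) : {ptws H * H -> C})).
  exact: initial_continuous.
have c3 : continuous (fun f : {ptws H * H -> C} => f (x, y)).
  exact: proj_continuous.
move=> t.
exact: (continuous_comp (continuous_comp (c1 t) (c2 _)) (c3 _)).
Qed.

Lemma SOT_dense_unitaries :
  dense [set t : set_type (isometries H : set (SOT H)) | unitaries dot (set_val t)].
Proof.
apply: (dense_of_finite_agreement _ H H
  (fun (T : bounded_operator H) x => T x) (isometries H) (unitaries dot)).
  exact: unitary_isometry.
move=> T s isoT; apply: (unitary_extension norm_dot) => x y _ _.
exact: (isometry_dot norm_dot isoT).
Qed.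

Lemma WOT_dense_unitaries : ~ finite_dimensional H ->
  dense [set t : set_type (contractions H : set (WOT dot)) |
    unitaries dot (set_val t)].
Proof.
move=> infH.
apply: (dense_of_finite_agreement _ (H * H)%type C
  (fun (T : bounded_operator H) xy => dot (T xy.1) xy.2)
  (contractions H) (unitaries dot)).
  by move=> U /(unitary_isometry norm_dot) isoU x; rewrite isoU.
move=> T s cT; pose xs := map fst s; pose L := map T xs ++ map snd s.
have [w [wq wL]] := gram_realization norm_dot _ xs L infH
  (contraction_defect_psd norm_dot cT).
(* The cross terms vanish because [L] contains every T x, and the Gram matrix of [w] fills the
   defect of T. As [L] also contains the second components of [s], <U x, y> = <T x, y> on [s]. *)
have [x y xxs yxs|U UU Uz] :=
    unitary_extension norm_dot xs (fun x => T x + w x).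
  have TL z : z \in xs -> T z \in L by move=> zxs; rewrite mem_cat map_f.
  rewrite linearDl !linearDr /= wq // (wL x (T y)) ?TL //.
  by rewrite (dotC (T x) (w y)) (wL y (T x)) ?TL // rmorph0 addr0 add0r addrC subrK.
exists U => // -[x y] xys.
rewrite /= Uz; last by apply/mapP; exists (x, y).
rewrite linearDl /= wL ?addr0 //; first by apply/mapP; exists (x, y).
by rewrite mem_cat; apply/orP; right; apply/mapP; exists (x, y).
Qed.

End operator_topologies.

(** * The G_delta statements and the conclusion *)

Lemma Gdelta_isometries (C : numClosedFieldType) (H : normedModType C)
    (dot : {dot H for Num.conj}) (norm_dot : forall x : H, `|x| = sqrtC (dot x x))
    (X : topologicalType) (op : X -> bounded_operator H) (u : H) :
  u != 0 -> separable H -> (forall t, contractions H (op t)) ->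
  (forall x y, continuous (fun t => dot (op t x) y)) ->
  Gdelta [set t | isometries H (op t)].
Proof.
move=> u0 /separable_sequence[d d_dense] cop op_cont.
rewrite (_ : [set t | _] = [set t | forall k j,
    norming (d := d) (d k) j (dot (op t (d k)))]).
  by apply: Gdelta_forall2 => k j; apply: open_norming.
by apply/seteqP; split=> t /(isometry_criterion norm_dot d_dense u _ u0 (cop t)).
Qed.

(** Unitaries are the isometries with dense range, by completeness. Only continuity of matrix
    coefficients enters, so an arbitrary [X] covers both operator topologies. *)
Lemma Gdelta_unitaries (C : numClosedFieldType) (H : completeNormedModType C)
    (dot : {dot H for Num.conj}) (norm_dot : forall x : H, `|x| = sqrtC (dot x x))
    (X : topologicalType) (op : X -> bounded_operator H) (u : H) :
  u != 0 -> separable H -> (forall t, contractions H (op t)) ->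
  (forall x y, continuous (fun t => dot (op t x) y)) ->
  Gdelta [set t | unitaries dot (op t)].
Proof.
move=> u0 /separable_sequence[d d_dense] cop op_cont.
rewrite (_ : [set t | _] = [set t | forall k j,
    ([set t | norming (d := d) (d k) j (dot (op t (d k)))] `&`
     [set t | norming (d := d) (d k) j (fun x => dot (op t x) (d k))]) t]).
  apply: Gdelta_forall2 => k j; apply: openI; apply: open_norming => //.
apply/seteqP; split=> t.
  move=> Ut k j; split; last exact: unitary_norming.
  apply: (isometry_criterion norm_dot d_dense u _ u0 (cop t)).1.
  exact: unitary_isometry.
move=> tP; have isot : isometries H (op t).
  by apply/(isometry_criterion norm_dot d_dense u _ u0 (cop t)) => k j;
    have [] := tP k j.
apply: surjective_isometry_unitary => //; apply: isometry_surjective => //.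
apply: (dense_range_of_norming norm_dot d_dense u) => // k j.
by have [] := tP k j.
Qed.

Theorem theorem7p1 (R : realType) (H : completeNormedModType R[i])
    (dot : {dot H for Num.conj})
    (norm_dot : forall x : H, `|x| = sqrtC (dot x x))
    (H_separable : separable H)
    (H_infinite_dimensional : ~ finite_dimensional H) :
  [/\ dense_Gdelta_in (isometries H : set (SOT H)) (unitaries dot),
      dense_Gdelta_in (contractions H : set (WOT dot)) (unitaries dot) &
      dense_Gdelta_in (contractions H : set (WOT dot)) (isometries H)].
Proof.
(* With an empty list this just supplies a nonzero vector, from which small nonzero slacks are
   obtained. *)
have [u u1 _] := orthogonal_unit_vector (dot := dot) [::] H_infinite_dimensional.
have u0 : u != 0 by rewrite -normr_eq0 u1 oner_neq0.
have iso_contr : isometries H `<=` contractions H by move=> T isoT x; rewrite isoT.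
have uni_iso := unitary_isometry norm_dot.
have set_typeP (A B : set (bounded_operator H)) (t : set_type A) :
    A `<=` B -> B (set_val t).
  by apply; apply: set_mem; exact: (valP t).
split; split.
- exact: uni_iso.
- exact: SOT_dense_unitaries.
- apply: (Gdelta_unitaries _ _ _ norm_dot _ _ u) => // [t|x y].
    exact: set_typeP.
  exact: SOT_continuous_dot.
- exact: subset_trans iso_contr.
- exact: WOT_dense_unitaries.
- apply: (Gdelta_unitaries _ _ _ norm_dot _ _ u) => // [t|x y].
    exact: set_typeP.
  exact: WOT_continuous_dot.
- exact: iso_contr.
(* Density passes from the unitaries to the larger set of isometries. *)
- move=> O O0 oO; have [t [Ot Ut]] :=
    WOT_dense_unitaries norm_dot H_infinite_dimensional O O0 oO.
  by exists t; split=> //; exact: uni_iso.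
- apply: (Gdelta_isometries _ _ _ norm_dot _ _ u) => // [t|x y].
    exact: set_typeP.
  exact: WOT_continuous_dot.
Qed.
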